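(* Let $\overline B$ be a graded connected unshuffle bialgebra over $k$ and $A$ a unital commutative $k$-algebra. For $\gamma_1,\gamma_2\in g_B(A)$, the left shuffle group law $\gamma_1\#\gamma_2:=\log^\prec\big(\mathcal E_\prec(\gamma_1)*\mathcal E_\prec(\gamma_2)\big)$ satisfies $$\gamma_1\#\gamma_2=\gamma_1+\mathrm e^{L_{\Omega'(\gamma_1)\rhd}}(\gamma_2)=\gamma_1+Ad_{\mathcal E_\prec(\gamma_1)^{-1}}(\gamma_2),$$ where $Ad_\Phi(\mu):=\Phi^{-1}\succ\mu\prec\Phi$ for $\Phi\in G_B(A)$, $\mu\in g_B(A)$.
   Context: $k$ is a field of characteristic zero. A graded connected unshuffle bialgebra is a graded unital counital bialgebra $\overline B=k\mathbf 1\oplus B$, $B=\bigoplus_{n\ge1}B_n$, with product $\cdot_B$ and coassociative coproduct $\Delta(c)=\bar\Delta(c)+c\otimes\mathbf 1+\mathbf 1\otimes c$ ($c\in B$), together with a splitting $\bar\Delta=\Delta_\prec+\Delta_\succ$ into graded linear maps $B\to B\otimes B$ such that $(\Delta_\prec\otimes\mathrm{id})\Delta_\prec=(\mathrm{id}\otimes\bar\Delta)\Delta_\prec$, $(\Delta_\succ\otimes\mathrm{id})\Delta_\prec=(\mathrm{id}\otimes\Delta_\prec)\Delta_\succ$, $(\bar\Delta\otimes\mathrm{id})\Delta_\succ=(\mathrm{id}\otimes\Delta_\succ)\Delta_\succ$, and, with $\Delta^+_\prec(a):=\Delta_\prec(a)+a\otimes\mathbf 1$, $\Delta^+_\succ(a):=\Delta_\succ(a)+\mathbf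 1\otimes a$, such that $\Delta^+_\prec(a\cdot_Bb)=\Delta^+_\prec(a)\cdot_B\Delta(b)$ and $\Delta^+_\succ(a\cdot_Bb)=\Delta^+_\succ(a)\cdot_B\Delta(b)$ for $a,b\in B$. For a unital commutative $k$-algebra $A$ with product $m_A$: $e:\overline B\to k\to A$ is the augmentation (unital on $k\mathbf 1$, zero on $B$); $f*g:=m_A(f\otimes g)\Delta$ for $f,g\in\mathrm{Lin}(\overline B,A)$, with unit $e$; $f\prec g:=m_A(f\otimes g)\Delta_\prec$ and $f\succ g:=m_A(f\otimes g)\Delta_\succ$ for $f,g\in\mathrm{Lin}(B,A)$ (viewed as the linear maps on $\overline B$ vanishing on $\mathbf 1$), extended bilinearly by $e\succ f=f=f\prec e$, $e\prec f=0=f\succ e$. The identity $(f\succ g)\prec h=f\succ(g\prec h)$ makes expressions $f\succ g\prec h$ unambiguous. $G_B(A)$ is the group (under $*$) of characters, i.e. unital algebra maps $\overline B\to A$; inverses are for $*$. $g_B(A)$ is the space of infinitesimal characters, i.e. linear $\kappa:\overline B\to A$ with $\kappa(\mathbf 1)=0$ and $\kappa(a\cdot_Bb)=0$ for $a,b\in B$. For $\alpha\in g_B(A)$: $\mathcal E_\prec(\alpha):=e+\sum_{n>0}\alpha^{\prec n}$ with $\alpha^{\prec 1}=\alpha$, $\alpha^{\prec n}=\alpha\prec\alpha^{\prec n-1}$; $\mathcal E_\prec:g_B(A)\to G_B(A)$ is a bijection with inverse $\log^\prec(\Phi)=(\Phi-e)\prec\Phi^{-1}$. Pre-Lie product: $f\rhd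 g:=f\succ g-g\prec f$ and $L_{f\rhd}(g):=f\rhd g$ on $\mathrm{Lin}(B,A)$; $\mathrm e^{L_{f\rhd}}=\sum_{n\ge 0}L_{f\rhd}^n/n!$. $\Omega'(\alpha)$ is the unique solution $X$ of $X=\sum_{m\ge0}\frac{B_m}{m!}L_{X\rhd}^m(\alpha)$ ($B_m$ the Bernoulli numbers, $B_1=-\frac12$). *)

(* Defs.v *)
From HB Require Import structures.
From mathcomp Require Import all_boot all_order all_algebra finmap.
From mathcomp Require Import boolp classical_sets functions cardinality fsbigop.
From mathcomp Require Import prodnormedzmodule.

Set Implicit Arguments.
Unset Strict Implicit.
Unset Printing Implicit Defensive.

Import GRing.Theory.
Local Open Scope classical_set_scope.
Local Open Scope ring_scope.
Local Open Scope quotient_scope.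

Section LinearMaps.
Context (k : comNzRingType) (U V : lmodType k).
Implicit Types f g h : {linear U -> V}.

Lemma linear_ext f g : f =1 g -> f = g.
Proof.
case: f g => [f [[h1] [h2]]] [g [[h3] [h4]]] /= /funext fg.
move: h1 h2 h3 h4; rewrite fg => h1 h2 h3 h4.
by rewrite (Prop_irrelevance h1 h3) (Prop_irrelevance h2 h4).
Qed.

Definition lin_zero : {linear U -> V} := [the {linear U -> V} of \0 : U -> V].
Definition lin_opp f : {linear U -> V} := [the {linear U -> V} of \- f : U -> V].
Definition lin_add f g : {linear U -> V} :=
  [the {linear U -> V} of f \+ g : U -> V].

Definition lin_scale_fun (c : k) f : U -> V := fun x => c *: f x.
Lemma lin_scale_is_linear c f : linear (lin_scale_fun c f).
Proof.
by move=> a u v; rewrite /lin_scale_fun linearP scalerDr !scalerA mulrC.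
Qed.
HB.instance Definition _ c f :=
  GRing.isLinear.Build k U V *:%R (lin_scale_fun c f) (lin_scale_is_linear c f).
Definition lin_scale c f : {linear U -> V} := lin_scale_fun c f.

Fact lin_addA : associative lin_add.
Proof. by move=> f g h; apply: linear_ext => x /=; rewrite addrA. Qed.
Fact lin_addC : commutative lin_add.
Proof. by move=> f g; apply: linear_ext => x /=; rewrite addrC. Qed.
Fact lin_add0 : left_id lin_zero lin_add.
Proof. by move=> f; apply: linear_ext => x /=; rewrite add0r. Qed.
Fact lin_addN : left_inverse lin_zero lin_opp lin_add.
Proof. by move=> f; apply: linear_ext => x /=; rewrite addNr. Qed.
HB.instance Definition _ := GRing.isZmodule.Build {linear U -> V}
  lin_addA lin_addC lin_add0 lin_addN.

Fact lin_scaleA a b f : lin_scale a (lin_scale b f) = lin_scale (a * b) f.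
Proof. by apply: linear_ext => x; rewrite /= /lin_scale_fun scalerA. Qed.
Fact lin_scale1 : left_id 1 lin_scale.
Proof. by move=> f; apply: linear_ext => x; rewrite /= /lin_scale_fun scale1r. Qed.
Fact lin_scaleDr : right_distributive lin_scale +%R.
Proof.
by move=> a f g; apply: linear_ext => x; rewrite /= /lin_scale_fun /= scalerDr.
Qed.
Fact lin_scaleDl f : {morph lin_scale^~ f : a b / a + b}.
Proof.
by move=> a b; apply: linear_ext => x; rewrite /= /lin_scale_fun scalerDl.
Qed.
HB.instance Definition _ := GRing.Zmodule_isLmodule.Build k {linear U -> V}
  lin_scaleA lin_scale1 lin_scaleDr lin_scaleDl.

Lemma lin_addE f g x : (f + g) x = f x + g x. Proof. by []. Qed.
Lemma lin_oppE f x : (- f) x = - f x. Proof. by []. Qed.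
Lemma lin_scaleE c f x : (c *: f) x = c *: f x. Proof. by []. Qed.
Lemma lin_zeroE x : (0 : {linear U -> V}) x = 0. Proof. by []. Qed.

(* Sum of a pointwise finite family of linear maps; 0 if some F ^~ x has
   infinite support. *)
Definition lsum_fun (F : nat -> {linear U -> V}) : U -> V := fun x =>
  if `[< forall y, finite_set [set n | F n y != 0] >]
  then \sum_(n \in [set: nat]) F n x else 0.

Fact lsum_is_linear F : linear (lsum_fun F).
Proof.
move=> a u v; rewrite /lsum_fun; case: asboolP => [fF|_]; last first.
  by rewrite scaler0 addr0.
pose S := [set n | F n u != 0] `|` [set n | F n v != 0].
have fS : finite_set S by rewrite finite_setU; split; apply: fF.
have E w : [set n | F n w != 0] `<=` S ->
    \sum_(n \in [set: nat]) F n w = \sum_(n <- fset_set S) F n w.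
  move=> wS; rewrite -(@fsbig_widen _ _ _ _ S) ?fsbig_finite// => n [_ nS].
  by apply: contrapT => /eqP /wS.
rewrite !E /S; first by rewrite scaler_sumr -big_split; apply: eq_bigr => i _;
  rewrite linearP.
- by move=> n ?; right.
- by move=> n ?; left.
move=> n /=; rewrite linearP; have [->|?] := eqVneq (F n u) 0; last by left.
by rewrite scaler0 add0r; right.
Qed.
HB.instance Definition _ F :=
  GRing.isLinear.Build k U V *:%R (lsum_fun F) (lsum_is_linear F).
Definition lsum F : {linear U -> V} := lsum_fun F.

End LinearMaps.

Section Bilin.
Context (k : comNzRingType) (U V W : lmodType k) (f : U -> V -> W).

Definition is_bilin : Prop := (forall v, linear (f^~ v)) /\ (forall u, linear (f u)).

Lemma is_bilinP : is_bilin -> bilinear_for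
  (GRing.Scale.Law.clone _ _ *:%R _) (GRing.Scale.Law.clone _ _ *:%R _) f.
Proof. by case=> h1 h2; split. Qed.
End Bilin.

Section Tensor.
Context (k : comNzRingType) (U V : lmodType k).

(* A sequence s stands for the formal sum of the u ox v with (u, v) in s.  Two
   formal sums are identified when no bilinear map separates them. *)
Definition tens_rel (s t : seq (U * V)) : bool :=
  `[< forall (W : lmodType k) (f : {bilinear U -> V -> W}),
      \sum_(z <- s) f z.1 z.2 = \sum_(z <- t) f z.1 z.2 >].

Fact tens_rel_refl : reflexive tens_rel.
Proof. by move=> s; apply/asboolP. Qed.
Fact tens_rel_sym : symmetric tens_rel.
Proof. by move=> s t; apply/asboolP/asboolP => h W f; rewrite h. Qed.
Fact tens_rel_trans : transitive tens_rel.
Proof.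
by move=> s t r /asboolP h /asboolP h'; apply/asboolP => W f; rewrite h h'.
Qed.
Canonical tens_equiv :=
  EquivRel tens_rel tens_rel_refl tens_rel_sym tens_rel_trans.

Definition tensor_type := {eq_quot tens_equiv}.
HB.instance Definition _ := Choice.on tensor_type.
HB.instance Definition _ := EqQuotient.on tensor_type.

Definition tlift_fun (W : lmodType k) (f : {bilinear U -> V -> W})
  (t : tensor_type) : W := \sum_(z <- repr t) f z.1 z.2.

Lemma tlift_pi (W : lmodType k) (f : {bilinear U -> V -> W}) s :
  tlift_fun f (\pi_tensor_type s) = \sum_(z <- s) f z.1 z.2.
Proof.
have /eqmodP /asboolP h : repr (\pi_tensor_type s) = s %[mod tensor_type] by rewrite reprK.
exact: h.
Qed.

Lemma tensorP (s t : tensor_type) :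
  (forall (W : lmodType k) (f : {bilinear U -> V -> W}),
    tlift_fun f s = tlift_fun f t) -> s = t.
Proof.
by move=> h; rewrite -[s]reprK -[t]reprK; apply/eqmodP/asboolP => W f; apply: h.
Qed.

Let sc (c : k) (z : U * V) := (c *: z.1, z.2).
Definition tens_zero : tensor_type := \pi_tensor_type [::].
Definition tens_add (s t : tensor_type) : tensor_type := \pi_tensor_type (repr s ++ repr t).
Definition tens_scale (c : k) (t : tensor_type) : tensor_type := \pi_tensor_type (map (sc c) (repr t)).

Let liftD (W : lmodType k) (f : {bilinear U -> V -> W}) s t :
  tlift_fun f (tens_add s t) = tlift_fun f s + tlift_fun f t.
Proof. by rewrite tlift_pi big_cat. Qed.
Let lift0 (W : lmodType k) (f : {bilinear U -> V -> W}) : tlift_fun f tens_zero = 0.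
Proof. by rewrite tlift_pi big_nil. Qed.
Let liftZ (W : lmodType k) (f : {bilinear U -> V -> W}) c t :
  tlift_fun f (tens_scale c t) = c *: tlift_fun f t.
Proof.
by rewrite tlift_pi big_map scaler_sumr; apply: eq_bigr => z _; rewrite linearZl_LR.
Qed.
Let liftE := (liftD, lift0, liftZ).

Fact tens_addA : associative tens_add.
Proof. by move=> r s t; apply: tensorP => W f; rewrite !liftE addrA. Qed.
Fact tens_addC : commutative tens_add.
Proof. by move=> s t; apply: tensorP => W f; rewrite !liftE addrC. Qed.
Fact tens_add0 : left_id tens_zero tens_add.
Proof. by move=> t; apply: tensorP => W f; rewrite !liftE add0r. Qed.
Fact tens_addN : left_inverse tens_zero (tens_scale (-1)) tens_add.
Proof. by move=> t; apply: tensorP => W f; rewrite !liftE scaleN1r addNr. Qed.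
HB.instance Definition _ := GRing.isZmodule.Build tensor_type
  tens_addA tens_addC tens_add0 tens_addN.

Fact tens_scaleA a b t : tens_scale a (tens_scale b t) = tens_scale (a * b) t.
Proof. by apply: tensorP => W f; rewrite !liftE scalerA. Qed.
Fact tens_scale1 : left_id 1 tens_scale.
Proof. by move=> t; apply: tensorP => W f; rewrite !liftE scale1r. Qed.
Fact tens_scaleDr : right_distributive tens_scale +%R.
Proof. by move=> a s t; apply: tensorP => W f; rewrite !liftE scalerDr. Qed.
Fact tens_scaleDl t : {morph tens_scale^~ t : a b / a + b}.
Proof. by move=> a b; apply: tensorP => W f; rewrite !liftE scalerDl. Qed.
HB.instance Definition _ := GRing.Zmodule_isLmodule.Build k tensor_type
  tens_scaleA tens_scale1 tens_scaleDr tens_scaleDl.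

Definition tensor : lmodType k := tensor_type.

Fact tlift_is_linear (W : lmodType k) (f : {bilinear U -> V -> W}) : linear (tlift_fun f).
Proof. by move=> a s t; rewrite liftD liftZ. Qed.
HB.instance Definition _ (W : lmodType k) (f : {bilinear U -> V -> W}) :=
  GRing.isLinear.Build k tensor_type W *:%R (tlift_fun f) (tlift_is_linear f).
Definition tlift (W : lmodType k) (f : {bilinear U -> V -> W}) : {linear tensor -> W} :=
  tlift_fun f.

Definition tens (u : U) (v : V) : tensor := \pi_tensor_type [:: (u, v)].

Let lift_tens (W : lmodType k) (f : {bilinear U -> V -> W}) u v : tlift_fun f (tens u v) = f u v.
Proof. by rewrite tlift_pi big_seq1. Qed.

Fact tens_is_bilinear : is_bilin tens.
Proof.
by split=> [u' | u] a x y; apply: tensorP => W f;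
  rewrite liftD liftZ !lift_tens ?linearPl ?linearPr.
Qed.
HB.instance Definition _ :=
  bilinear_isBilinear.Build k U V tensor *:%R *:%R tens (is_bilinP tens_is_bilinear).

Lemma tlift_tens (W : lmodType k) (f : {bilinear U -> V -> W}) u v : tlift f (tens u v) = f u v.
Proof. exact: lift_tens. Qed.

Lemma tensorE (t : tensor) : t = \sum_(z <- repr (t : tensor_type)) tens z.1 z.2.
Proof.
apply: tensorP => W f; rewrite -[RHS]/(tlift f _) linear_sum.
by apply: eq_bigr => z _; rewrite tlift_tens.
Qed.

Lemma tlift_unique (W : lmodType k) (g h : {linear tensor -> W}) :
  (forall u v, g (tens u v) = h (tens u v)) -> g = h.
Proof.
move=> gh; apply: linear_ext => t.
by rewrite [t]tensorE !linear_sum; apply: eq_bigr.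
Qed.

Lemma tlift_lin (W : lmodType k) (f g h : {bilinear U -> V -> W}) a :
    (forall u v, f u v = a *: g u v + h u v) ->
  forall t, tlift f t = a *: tlift g t + tlift h t.
Proof.
move=> fE t; have -> : tlift f = a *: tlift g + tlift h.
  by apply: tlift_unique => u v; rewrite lin_addE lin_scaleE !tlift_tens.
by rewrite lin_addE lin_scaleE.
Qed.

End Tensor.

Reserved Notation "x \ox y" (at level 40, left associativity).
Notation "x \ox y" := (tens x y) : ring_scope.

Section TensorMaps.
Context (k : comNzRingType).

Section Map.
Context (U V U' V' : lmodType k) (f : {linear U -> U'}) (g : {linear V -> V'}).

Definition tmap_fun (u : U) (v : V) : tensor U' V' := f u \ox g v.
Fact tmap_fun_bilinear : is_bilin tmap_fun.
Proof.
by split=> [v | u] a x y; rewrite /tmap_fun linearP ?linearPl ?linearPr.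
Qed.
HB.instance Definition _ :=
  bilinear_isBilinear.Build k U V (tensor U' V') *:%R *:%R
    tmap_fun (is_bilinP tmap_fun_bilinear).
Definition tmap : {linear tensor U V -> tensor U' V'} := tlift tmap_fun.

Lemma tmapE u v : tmap (u \ox v) = f u \ox g v.
Proof. exact: tlift_tens. Qed.
End Map.

Section Assoc.
Context (U V W : lmodType k).

Definition tassoc1_fun (w : W) (u : U) (v : V) : tensor U (tensor V W) :=
  u \ox (v \ox w).
Fact tassoc1_bilinear w : is_bilin (tassoc1_fun w).
Proof.
by split=> [v | u] a x y; rewrite /tassoc1_fun ?linearPl ?linearPr.
Qed.
HB.instance Definition _ w :=
  bilinear_isBilinear.Build k U V (tensor U (tensor V W)) *:%R *:%R
    (tassoc1_fun w) (is_bilinP (tassoc1_bilinear w)).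

Definition tassoc_fun (t : tensor U V) (w : W) : tensor U (tensor V W) :=
  tlift (tassoc1_fun w) t.
Fact tassoc_bilinear : is_bilin tassoc_fun.
Proof.
split=> [w | t] a x y; rewrite /tassoc_fun ?linearP//.
by apply: tlift_lin => u v /=; rewrite /tassoc1_fun !linearPr.
Qed.
HB.instance Definition _ :=
  bilinear_isBilinear.Build k (tensor U V) W (tensor U (tensor V W)) *:%R *:%R
    tassoc_fun (is_bilinP tassoc_bilinear).
Definition tassoc : {linear tensor (tensor U V) W -> tensor U (tensor V W)} :=
  tlift tassoc_fun.

Lemma tassocE u v w : tassoc (u \ox v \ox w) = u \ox (v \ox w).
Proof. by rewrite /tassoc tlift_tens /= /tassoc_fun tlift_tens. Qed.
End Assoc.

Section Mul.
Context (H K : algType k).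
Implicit Types s t : tensor H K.

Definition tmul1_fun s (x : H) (y : K) : tensor H K :=
  tmap [the {linear H -> H} of x \o* idfun : H -> H]
       [the {linear K -> K} of y \o* idfun : K -> K] s.
Fact tmul1_bilinear s : is_bilin (tmul1_fun s).
Proof.
by split=> [y | x] a z z'; apply: tlift_lin => u v /=;
  rewrite /tmap_fun /= mulrDr -scalerAr ?linearPl ?linearPr.
Qed.
HB.instance Definition _ s :=
  bilinear_isBilinear.Build k H K (tensor H K) *:%R *:%R
    (tmul1_fun s) (is_bilinP (tmul1_bilinear s)).

Definition tmul s t : tensor H K := tlift (tmul1_fun s) t.

Lemma tmulE x y x' y' : tmul (x \ox y) (x' \ox y') = (x * x') \ox (y * y').
Proof. by rewrite /tmul tlift_tens /= /tmul1_fun tmapE. Qed.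

Lemma tmul_linearr s : linear (tmul s).
Proof. by move=> a t t'; rewrite /tmul linearP. Qed.

Lemma tmul_linearl t : linear (tmul^~ t).
Proof.
move=> a s s'; apply: tlift_lin => x y /=.
by rewrite /tmul1_fun linearP.
Qed.
End Mul.

Section Pairing.
Context (U V : lmodType k) (A : algType k).
Context (f : {linear U -> A}) (g : {linear V -> A}).

Definition mtens_fun (u : U) (v : V) : A := f u * g v.
Fact mtens_bilinear : is_bilin mtens_fun.
Proof.
split=> [v | u] a x y; rewrite /mtens_fun linearP.
  by rewrite mulrDl scalerAl.
by rewrite mulrDr scalerAr.
Qed.
HB.instance Definition _ :=
  bilinear_isBilinear.Build k U V A *:%R *:%R mtens_fun (is_bilinP mtens_bilinear).

(* m_A (f (x) g) *)
Definition mtens : {linear tensor U V -> A} := tlift mtens_fun.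

Lemma mtensE u v : mtens (u \ox v) = f u * g v.
Proof. exact: tlift_tens. Qed.
End Pairing.

End TensorMaps.

Record is_graded_alg (k : fieldType) (H : algType k) (gr : nat -> {pred H}) : Prop := {
  gr_submod : forall n, submod_closed (gr n);
  gr_span : forall x, exists n (s : nat -> H),
    (forall i, s i \in gr i) /\ x = \sum_(i < n) s i;
  gr_free : forall n (s : nat -> H), (forall i, s i \in gr i) ->
    \sum_(i < n) s i = 0 -> forall i, (i < n)%N -> s i = 0;
  gr_one : 1 \in gr 0;
  gr_mul : forall m n x y, x \in gr m -> y \in gr n -> x * y \in gr (m + n)%N
}.

(* sum of the H_p (x) H_q over the bidegrees (p, q) with P p q *)
Definition tens_bideg (k : fieldType) (H : algType k) (gr : nat -> {pred H}) (P : rel nat)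
    (t : tensor H H) : Prop :=
  exists s : seq (H * H), t = \sum_(z <- s) z.1 \ox z.2 /\
    forall z, z \in s -> exists p q, [/\ P p q, z.1 \in gr p & z.2 \in gr q].

Record gradedBialgebra (k : fieldType) := GradedBialgebra {
  gb_alg :> algType k;
  gb_gr : nat -> {pred gb_alg};
  gb_Delta : {linear gb_alg -> tensor gb_alg gb_alg};
  gb_eps : {lrmorphism gb_alg -> k^o};
  gb_grP : is_graded_alg gb_gr;
  gb_Delta_gr : forall n x, x \in gb_gr n ->
    tens_bideg gb_gr (fun p q => p + q == n)%N (gb_Delta x);
  gb_eps_gr : forall n x, x \in gb_gr n.+1 -> gb_eps x = 0;
  gb_Delta1 : gb_Delta 1 = 1 \ox 1;
  gb_DeltaM : forall x y, gb_Delta (x * y) = tmul (gb_Delta x) (gb_Delta y);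
  gb_coassoc : forall x,
    tassoc _ _ _ (tmap gb_Delta idfun (gb_Delta x)) =
    tmap idfun gb_Delta (gb_Delta x);
  (* counit laws, with H identified with k (x) H and H (x) k *)
  gb_counitl : forall x, tmap gb_eps idfun (gb_Delta x) = 1 \ox x;
  gb_counitr : forall x, tmap idfun gb_eps (gb_Delta x) = x \ox 1
}.

Arguments gb_gr {k} H n : rename.

(* the summand B of Bbar = k1 + B *)
Definition gb_pos (k : fieldType) (H : gradedBialgebra k) (x : H) : Prop :=
  exists n (s : nat -> H),
    (forall i, s i \in gb_gr H i.+1) /\ x = \sum_(i < n) s i.

(* A linear map B -> B (x) B is encoded as the linear map Bbar -> Bbar (x) Bbar
   that agrees with it on B and vanishes on 1; B (x) B embeds in Bbar (x) Bbar,
   B being a direct summand of Bbar. *)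
Record unshuffleBialgebra (k : fieldType) := UnshuffleBialgebra {
  ub_bialg :> gradedBialgebra k;
  ub_connected : forall x, x \in gb_gr ub_bialg 0 <-> exists c : k, x = c%:A;
  ub_prec : {linear ub_bialg -> tensor ub_bialg ub_bialg};
  ub_succ : {linear ub_bialg -> tensor ub_bialg ub_bialg};
  ub_prec1 : ub_prec 1 = 0;
  ub_succ1 : ub_succ 1 = 0;
  ub_prec_gr : forall n x, x \in gb_gr ub_bialg n.+1 ->
    tens_bideg (gb_gr ub_bialg)
      (fun p q => [&& 0 < p, 0 < q & p + q == n.+1])%N (ub_prec x);
  ub_succ_gr : forall n x, x \in gb_gr ub_bialg n.+1 ->
    tens_bideg (gb_gr ub_bialg)
      (fun p q => [&& 0 < p, 0 < q & p + q == n.+1])%N (ub_succ x);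
  ub_split : forall x, gb_pos x ->
    gb_Delta ub_bialg x = (ub_prec x + ub_succ x) + x \ox 1 + 1 \ox x;
  ub_precprec : forall x, gb_pos x ->
    tassoc _ _ _ (tmap ub_prec idfun (ub_prec x)) =
    tmap idfun (ub_prec + ub_succ) (ub_prec x);
  ub_succprec : forall x, gb_pos x ->
    tassoc _ _ _ (tmap ub_succ idfun (ub_prec x)) =
    tmap idfun ub_prec (ub_succ x);
  ub_succsucc : forall x, gb_pos x ->
    tassoc _ _ _ (tmap (ub_prec + ub_succ) idfun (ub_succ x)) =
    tmap idfun ub_succ (ub_succ x);
  ub_precM : forall a b, gb_pos a -> gb_pos b ->
    ub_prec (a * b) + (a * b) \ox 1 =
    tmul (ub_prec a + a \ox 1) (gb_Delta ub_bialg b);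
  ub_succM : forall a b, gb_pos a -> gb_pos b ->
    ub_succ (a * b) + 1 \ox (a * b) =
    tmul (ub_succ a + 1 \ox a) (gb_Delta ub_bialg b)
}.

(* [:: B_0; ...; B_(n-1)] in a field of characteristic 0, from the recurrence
   \sum_(j <= m) 'C(m.+1, j) B_j = [m = 0] *)
Fixpoint bernoulli_seq (F : fieldType) (n : nat) : seq F :=
  if n is m.+1 then
    let s := bernoulli_seq F m in
    rcons s (((m == 0)%:R - \sum_(j < m) 'C(m.+1, j)%:R * s`_j) / m.+1%:R)
  else [::].

Definition bernoulli (F : fieldType) (m : nat) : F := (bernoulli_seq F m.+1)`_m.

Section Bernoulli.
Context (F : fieldType).

Lemma size_bernoulli_seq n : size (bernoulli_seq F n) = n.
Proof. by elim: n => //= n IH; rewrite size_rcons IH. Qed.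

Lemma nth_bernoulli_seq n i : (i < n)%N -> (bernoulli_seq F n)`_i = bernoulli F i.
Proof.
elim: n => // n IH; rewrite ltnS leq_eqVlt => /predU1P[->//|lt_in].
by rewrite /= nth_rcons size_bernoulli_seq lt_in IH.
Qed.

Lemma bernoulliE m : [pchar F] =i pred0 ->
  \sum_(j < m.+1) 'C(m.+1, j)%:R * bernoulli F j = (m == 0)%:R.
Proof.
move=> F0; rewrite big_ord_recr /= {2}/bernoulli /= nth_rcons size_bernoulli_seq.
rewrite ltnn eqxx binSn mulrC divfK; last by move/pcharf0P: F0 => ->.
under [X in _ - X]eq_bigr => j _ do rewrite nth_bernoulli_seq//.
by rewrite addrC subrK.
Qed.

Lemma bernoulli1 : [pchar F] =i pred0 -> bernoulli F 1 = - 2^-1.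
Proof.
move=> F0; rewrite /bernoulli /= !big_ord_recr !big_ord0 /= divr1.
by rewrite !(sub0r, add0r, subr0) mulr1 mulNr div1r.
Qed.
End Bernoulli.

Section Shuffle.
Context (k : fieldType) (H : unshuffleBialgebra k) (A : comAlgType k).
Notation Lin := {linear H -> A}.
Implicit Types f g h : Lin.

Definition aug_fun (x : H) : A := (gb_eps H x)%:A.
Fact aug_is_linear : linear aug_fun.
Proof. by move=> a x y; rewrite /aug_fun linearP /= scalerDl scalerA. Qed.
HB.instance Definition _ :=
  GRing.isLinear.Build k H A *:%R aug_fun aug_is_linear.
Definition aug : Lin := aug_fun.

Definition conv f g : Lin :=
  [the {linear H -> A} of mtens f g \o gb_Delta H : H -> A].

Definition lmulA (a : A) f : Lin := [the {linear H -> A} of a \*o f : H -> A].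

(* Lin(B, A) is the space of the f with f 1 = 0; redl f is the component of f
   in Lin(B, A) for the decomposition Lin(Bbar, A) = A e + Lin(B, A). *)
Definition redl f : Lin := f - lmulA (f 1) aug.

(* Bilinear extensions of the half-shuffles of Lin(B, A); see hprec_aug,
   aug_hprec, aug_hsucc and hsucc_aug. The values of e < e and e > e are
   immaterial (and 0). *)
Definition hprec f g : Lin :=
  [the {linear H -> A} of mtens (redl f) (redl g) \o ub_prec H : H -> A]
  + lmulA (g 1) (redl f).
Definition hsucc f g : Lin :=
  [the {linear H -> A} of mtens (redl f) (redl g) \o ub_succ H : H -> A]
  + lmulA (f 1) (redl g).

Lemma aug1 : aug 1 = 1.
Proof. by rewrite /= /aug_fun rmorph1 scale1r. Qed.

Lemma redl_id f : f 1 = 0 -> redl f = f.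
Proof.
move=> f1; apply: linear_ext => x.
by rewrite lin_addE lin_oppE /= f1 mul0r subr0.
Qed.

Lemma redl_aug : redl aug = 0.
Proof.
apply: linear_ext => x.
by rewrite lin_addE lin_oppE [lmulA _ _ _]/= aug1 mul1r subrr.
Qed.

Lemma mtens0l (g : Lin) : mtens (0 : Lin) g = 0.
Proof. by apply: tlift_unique => u v; rewrite mtensE lin_zeroE mul0r. Qed.

Lemma mtens0r (f : Lin) : mtens f (0 : Lin) = 0.
Proof. by apply: tlift_unique => u v; rewrite mtensE lin_zeroE mulr0. Qed.

Lemma hprec_def f g x :
  hprec f g x = mtens (redl f) (redl g) (ub_prec H x) + g 1 * redl f x.
Proof. by []. Qed.

Lemma hsucc_def f g x :
  hsucc f g x = mtens (redl f) (redl g) (ub_succ H x) + f 1 * redl g x.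
Proof. by []. Qed.

Lemma hprecE f g x : f 1 = 0 -> g 1 = 0 -> hprec f g x = mtens f g (ub_prec H x).
Proof. by move=> f1 g1; rewrite hprec_def !redl_id// g1 mul0r addr0. Qed.

Lemma hsuccE f g x : f 1 = 0 -> g 1 = 0 -> hsucc f g x = mtens f g (ub_succ H x).
Proof. by move=> f1 g1; rewrite hsucc_def !redl_id// f1 mul0r addr0. Qed.

Lemma hprec_aug f : f 1 = 0 -> hprec f aug = f.
Proof.
move=> f1; apply: linear_ext => x; rewrite hprec_def aug1 mul1r.
by rewrite (redl_id f1) redl_aug mtens0r lin_zeroE add0r.
Qed.

Lemma aug_hsucc f : f 1 = 0 -> hsucc aug f = f.
Proof.
move=> f1; apply: linear_ext => x; rewrite hsucc_def aug1 mul1r.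
by rewrite (redl_id f1) redl_aug mtens0l lin_zeroE add0r.
Qed.

Lemma aug_hprec f : f 1 = 0 -> hprec aug f = 0.
Proof.
move=> f1; apply: linear_ext => x; rewrite hprec_def f1 mul0r.
by rewrite redl_aug mtens0l lin_zeroE addr0.
Qed.

Lemma hsucc_aug f : f 1 = 0 -> hsucc f aug = 0.
Proof.
move=> f1; apply: linear_ext => x; rewrite hsucc_def f1 mul0r.
by rewrite redl_aug mtens0r lin_zeroE addr0.
Qed.

(* the inverse for conv, unique when it exists *)
Definition conv_inv f : Lin :=
  xget 0 [set g : Lin | conv f g = aug /\ conv g f = aug].

Definition infchar (f : Lin) : Prop :=
  f 1 = 0 /\ forall a b : H, gb_pos a -> gb_pos b -> f (a * b) = 0.

(* iter n (hprec f) f  is the (n+1)-st left half-shuffle power of f *)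
Definition Eprec f : Lin := aug + lsum (fun n => iter n (hprec f) f).

Definition logprec f : Lin := hprec (f - aug) (conv_inv f).

Definition lshuffle f g : Lin := logprec (conv (Eprec f) (Eprec g)).

Definition Ad f g : Lin := hprec (hsucc (conv_inv f) g) f.

Definition prelie f g : Lin := hsucc f g - hprec g f.

Definition exp_prelie f g : Lin :=
  lsum (fun n => (n`!%:R)^-1 *: iter n (prelie f) g).

Definition magnus_eq f (X : Lin) : Prop :=
  X 1 = 0 /\
  X = lsum (fun m => (bernoulli k m / m`!%:R) *: iter m (prelie X) f).

(* the unique solution, in Lin(B, A), of the fixed point equation *)
Definition Omega' f : Lin :=
  xget 0 [set X : Lin | magnus_eq f X /\ forall Y, magnus_eq f Y -> Y = X].

End Shuffle.

(* Main.v *)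
From HB Require Import structures.
Require Import Defs.
From mathcomp Require Import all_boot all_order all_algebra ring.
From mathcomp Require Import boolp classical_sets cardinality fsbigop.

Import GRing.Theory.
Local Open Scope ring_scope.

(* Write < and > for the half-shuffles, F_i = E_<(gamma_i) and L = L_X|>.  Since
   F_1 = e + gamma_1 < F_1, the dual half-shuffle relations give
     (gamma_1 + F_1 > gamma_2 < F_1^-1) < (F_1 * F_2)
       = (F_1 - e) < F_2 + F_1 > (F_2 - e) = F_1 * F_2 - e,
   and applying (- < (F_1 * F_2)^-1) yields the formula with Ad.
   For the one with X = Omega'(gamma_1), the generating function of the
   Bernoulli numbers inverts the fixed point equation into
   gamma_1 = sum_n L^n(X) / (n+1)!.  The operators rho = (- < X) and L commute
   and rho + L = (X > -), so that binomial expansions give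
     X^{*(n+1)} = sum_a 'C(n+1, a) rho^a L^(n-a) X
     and (X > -)^n = sum_a 'C(n, a) rho^a L^(n-a).
   Divided by factorials and summed, the first reads
   exp*(X) = e + gamma_1 < exp*(X), i.e. exp*(X) = F_1, and the second
   F_1 > gamma_2 = e^L(gamma_2) < F_1.
   All infinite sums converge for the filtration by degree. *)

Set Implicit Arguments.
Unset Strict Implicit.
Unset Printing Implicit Defensive.

(** * Pairings of tensors with values in $A$ *)

Section Pairings.
Context (k : fieldType) (A : comAlgType k).

Lemma mtens_comp (U V U' V' : lmodType k) (f : {linear U' -> A}) (g : {linear V' -> A})
    (a : {linear U -> U'}) (b : {linear V -> V'}) (t : tensor U V) :
  mtens f g (tmap a b t) = mtens (f \o a : {linear U -> A}) (g \o b : {linear V -> A}) t.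
Proof.
rewrite -[LHS]/((mtens f g \o tmap a b : {linear _ -> _}) t); congr (_ t).
congr GRing.Linear.sort.
by apply: tlift_unique => u v; rewrite /= tmapE !mtensE.
Qed.

Lemma mtens_assoc (U V W : lmodType k) (f : {linear U -> A}) (g : {linear V -> A})
    (h : {linear W -> A}) (t : tensor (tensor U V) W) :
  mtens f (mtens g h) (tassoc U V W t) = mtens (mtens f g) h t.
Proof.
pose L : {linear tensor (tensor U V) W -> A} := mtens f (mtens g h) \o tassoc U V W.
rewrite -[LHS]/(L t); congr (GRing.Linear.sort _ t); apply: tlift_unique => s w.
rewrite /L (tensorE s) linear_sumlz !linear_sum; apply: eq_bigr => -[u v] _ /=.
by rewrite tassocE !mtensE mulrA.
Qed.
End Pairings.

(** * Degree filtration and summable families *)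

Section Filtration.
Context (k : fieldType) (H : gradedBialgebra k) (V : lmodType k).
Notation Lin := {linear H -> V}.
Implicit Types f g : Lin.

(** Decreasing filtration of the space of linear maps by degree. [vanish n (f - g)] plays the role
    of a congruence modulo its $n$-th step, and all limits are taken in this sense. *)
Definition vanish (n : nat) f : Prop :=
  forall i x, (i < n)%N -> x \in gb_gr H i -> f x = 0.

Lemma vanish_le m n f : (m <= n)%N -> vanish n f -> vanish m f.
Proof. by move=> mn fn i x im; apply: fn; apply: leq_trans mn. Qed.

Lemma vanishT f : vanish 0 f. Proof. by []. Qed.

Lemma vanishD n f g : vanish n f -> vanish n g -> vanish n (f + g).
Proof. by move=> fn gn i x xn xi; rewrite lin_addE (fn i)// (gn i)// addr0. Qed.

Lemma vanishN n f : vanish n f -> vanish n (- f).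
Proof. by move=> fn i x xn xi; rewrite lin_oppE (fn i)// oppr0. Qed.

Lemma vanishB n f g : vanish n f -> vanish n g -> vanish n (f - g).
Proof. by move=> fn gn; apply/vanishD/vanishN. Qed.

Lemma vanishZ n c f : vanish n f -> vanish n (c *: f).
Proof. by move=> fn i x xn xi; rewrite lin_scaleE (fn i)// scaler0. Qed.

Lemma vanish_sum n (I : Type) (r : seq I) (P : pred I) (F : I -> Lin) :
  (forall i, P i -> vanish n (F i)) -> vanish n (\sum_(i <- r | P i) F i).
Proof. by move=> h; apply: (big_ind (vanish n)) => //; apply: vanishD. Qed.

Lemma lin_sumE (I : Type) (r : seq I) (P : pred I) (F : I -> Lin) x :
  (\sum_(i <- r | P i) F i) x = \sum_(i <- r | P i) F i x.
Proof. by elim/big_rec2: _ => [//|i a f _ <-]; rewrite lin_addE. Qed.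

Lemma lin_gr_ext f g : (forall n x, x \in gb_gr H n -> f x = g x) -> f = g.
Proof.
move=> fg; apply: linear_ext => x.
have [n [s [sP ->]]] := gr_span (gb_grP H) x.
by rewrite !linear_sum; apply: eq_bigr => i _; apply: fg (sP i).
Qed.

Lemma vanish_eq f g : (forall n, vanish n (f - g)) -> f = g.
Proof.
move=> fg; apply: lin_gr_ext => n x xn; apply/eqP; rewrite -subr_eq0; apply/eqP.
exact: (fg n.+1 n x).
Qed.

Lemma vanish_trans n f g h : vanish n (f - g) -> vanish n (g - h) -> vanish n (f - h).
Proof. by move=> fg gh; rewrite -(subrKA g); apply: vanishD. Qed.

Lemma vanish_sym n f g : vanish n (f - g) -> vanish n (g - f).
Proof. by move=> fg; rewrite -opprB; apply: vanishN. Qed.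

(** Stronger than the pointwise finiteness tested by [lsum]: in degree $n$ only terms of index at
    most $n$ contribute, so truncations are explicit. *)
Definition summable (F : nat -> Lin) : Prop := forall n, vanish n (F n).

Lemma lsum_gr F n N x : summable F -> x \in gb_gr H n -> (n < N)%N ->
  lsum F x = \sum_(i < N) F i x.
Proof.
move=> sF xn nN; rewrite /lsum /= /lsum_fun; case: asboolP => [_|]; last first.
  (* The default value $0$ of [lsum_fun] does not occur: $y$ has components in degrees below some
     $M$ only, so [F m y] is zero once $M\le m$. *)
  case=> y; have [M [s [sP ->]]] := gr_span (gb_grP H) y.
  apply: (@sub_finite_set _ _ `I_M%classic _ (finite_II M)) => m /=.
  case: (ltnP m M) => // Mm /eqP[]; rewrite linear_sum big1// => i _.
  by apply: (sF m i); rewrite // (leq_trans _ Mm).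
rewrite (fsbig_ord _ N (fun i => F i x)); apply/esym/fsbig_widen => // m [_ /=] /negP.
by rewrite -leqNgt => Nm; apply: (sF m n x _ xn); apply: leq_trans Nm.
Qed.

Lemma lsum_approx F n N : summable F -> (n <= N)%N ->
  vanish n (lsum F - \sum_(i < N) F i).
Proof.
move=> sF nN i x xn xi; rewrite lin_addE lin_oppE (lsum_gr sF xi (leq_trans xn nN)).
by rewrite lin_sumE subrr.
Qed.

Lemma lsum_unique F f : summable F ->
  (forall n, vanish n (f - \sum_(i < n) F i)) -> f = lsum F.
Proof.
move=> sF fF; apply: vanish_eq => n; apply: vanish_trans (fF n) _.
exact/vanish_sym/lsum_approx.
Qed.

Lemma vanish_lsum n F : summable F -> (forall i, vanish n (F i)) -> vanish n (lsum F).
Proof.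
move=> sF nF; rewrite -[lsum F](subrK (\sum_(i < n) F i)).
by apply: vanishD; [exact: lsum_approx | exact: vanish_sum].
Qed.

(** A linear operator that respects the filtration is continuous, hence commutes with summable
    series. *)
Lemma lsum_linear F (T : Lin -> Lin) :
    linear T -> (forall n f, vanish n f -> vanish n (T f)) -> summable F ->
  T (lsum F) = lsum (fun n => T (F n)).
Proof.
move=> Tl Tn sF; pose Tm := GRing.isLinear.Build k Lin Lin *:%R T Tl.
pose L : {linear Lin -> Lin} := HB.pack T Tm.
rewrite -[T _]/(L _); apply: lsum_unique => [n|n]; first exact/Tn/sF.
by rewrite -[X in _ - X](linear_sum L) -[X in vanish _ X](linearB L); apply/Tn/lsum_approx.
Qed.

Lemma lsumB (F G : nat -> Lin) : summable F -> summable G ->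
  lsum F - lsum G = lsum (fun n => F n - G n).
Proof.
move=> sF sG; apply: lsum_unique => [n|n]; first by apply: vanishB.
rewrite sumrB opprD addrACA -(opprD (lsum G)).
by apply: vanishB; apply: lsum_approx.
Qed.

Lemma lsumZ (c : k) F : summable F -> c *: lsum F = lsum (fun n => c *: F n).
Proof.
move=> sF; apply: (@lsum_linear _ ( *:%R c)) => // [a f g|n f]; last exact: vanishZ.
by rewrite scalerDr !scalerA mulrC.
Qed.

Lemma lsum_recl F : summable F -> lsum F = F 0%N + lsum (fun n => F n.+1).
Proof.
move=> sF; have sF' : summable (fun n => F n.+1).
  by move=> n; apply: vanish_le (sF n.+1).
apply/esym/lsum_unique => // -[//|n].
rewrite big_ord_recl opprD addrACA subrr add0r /=.
(* The approximation of the shifted series has one term more than wanted; this extra term [F n.+1]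
   lies itself in step [n.+1]. *)
have := lsum_approx sF' (leqnn n.+1); rewrite big_ord_recr /= opprD addrA => h.
rewrite -[X in vanish _ X](subrK (F n.+1)); apply: vanishD => //; exact: sF.
Qed.

Lemma lsum_split F N : summable F ->
  lsum F = \sum_(i < N) F i + lsum (fun n => F (N + n)%N).
Proof.
elim: N F => [|N IH] F sF; first by rewrite big_ord0 add0r.
rewrite lsum_recl// IH; last by move=> n; apply: vanish_le (sF n.+1).
by rewrite big_ord_recl addrA.
Qed.

Lemma eq_lsum (F G : nat -> Lin) : F =1 G -> lsum F = lsum G.
Proof. by move=> FG; congr lsum; apply: funext. Qed.

(** Fubini along antidiagonals: modulo step $n$ both sides reduce to the finite sum over the
    triangle $i+j<n$. *)
Lemma lsum_double (F : nat -> nat -> Lin) :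
    (forall i j, vanish (i + j) (F i j)) ->
  lsum (fun i => lsum (F i)) = lsum (fun n => \sum_(i < n.+1) F i (n - i)%N).
Proof.
move=> sF.
have sFi i : summable (F i) by move=> n; apply: vanish_le (sF i n); rewrite leq_addl.
have sI : summable (fun i => lsum (F i)).
  by move=> n; apply: vanish_lsum => // i; apply: vanish_le (sF n i); rewrite leq_addr.
apply: lsum_unique => [n|n].
  by apply: vanish_sum => i _; apply: vanish_le (sF i (n - i)%N); rewrite subnKC// -ltnS.
apply: vanish_trans (lsum_approx sI (leqnn n)) _.
have -> : \sum_(m < n) \sum_(i < m.+1) F i (m - i)%N =
          \sum_(i < n) \sum_(j < n - i) F i j.
  elim: n => [|n IH]; first by rewrite !big_ord0.
  rewrite big_ord_recr /= IH [RHS]big_ord_recr /= subSnn big_ord_recr /= subnn.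
  rewrite addrA big_ord1 -big_split /=; congr (_ + _); apply: eq_bigr => i _.
  by rewrite subSn ?(ltnW (ltn_ord i))// big_ord_recr.
rewrite -sumrB; apply: vanish_sum => i _.
(* The rest of row $i$ starts at index $n-i$, hence lies in step $i+(n-i)=n$. *)
rewrite (lsum_split (n - i)%N (sFi i)) addrAC subrr add0r.
have iE : (i + (n - i))%N = n by rewrite subnKC// ltnW.
apply: vanish_lsum => [m|m]; [apply: vanish_le (sF i _)|apply: vanish_le (sF i _)].
  by rewrite addnA -[X in (X <= _)%N]add0n leq_add.
by rewrite addnA iE leq_addr.
Qed.

(* lim T^n(0), written as the telescoping sum of the T^(n+1)(0) - T^n(0) *)
Lemma contraction_fixpoint (T : Lin -> Lin) :
    (forall n f g, vanish n (f - g) -> vanish n.+1 (T f - T g)) ->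
  exists2 f, f = T f & forall g, g = T g -> g = f.
Proof.
move=> Tc; pose u n := iter n T 0.
have su : summable (fun n => u n.+1 - u n).
  by elim=> [//|n IH]; apply: Tc.
pose f := lsum (fun n => u n.+1 - u n).
have fu n : vanish n (f - u n).
  have := lsum_approx su (leqnn n).
  by rewrite -(big_mkord xpredT (fun n => u n.+1 - u n)) telescope_sumr// subr0.
exists f => [|g gT].
  apply: vanish_eq => n; apply: vanish_trans (vanish_le (leqnSn n) (fu n.+1)) _.
  exact/vanish_sym/(vanish_le (leqnSn n))/Tc.
apply: vanish_eq; elim=> // n IH.
rewrite gT; apply: vanish_trans (Tc _ _ _ IH) _.
by apply: (@vanish_trans _ _ (u n.+1)); [exact: Tc | exact/vanish_sym].
Qed.

End Filtration.

(** * Half-shuffle products *)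

Section HalfShuffles.
Context (k : fieldType) (H : unshuffleBialgebra k) (A : comAlgType k).
Notation Lin := {linear H -> A}.
Notation e := (aug H A).
Implicit Types (f g h : Lin) (D : {linear H -> tensor H H}).

(** Convolution along an arbitrary coproduct. The full coproduct gives [conv]; the two
    half-coproducts give [hprec] and [hsucc] up to the terms that encode the rules for $e$. *)
Definition cprod D f g : Lin := [the {linear H -> A} of mtens f g \o D : H -> A].
Local Notation P := (cprod (ub_prec H)).
Local Notation S := (cprod (ub_succ H)).

Lemma lmulAE (a : A) f x : lmulA a f x = a * f x. Proof. by []. Qed.

Lemma redlE f x : redl f x = f x - f 1 * e x. Proof. by []. Qed.

Lemma redl1 f : redl f 1 = 0.
Proof. by rewrite redlE aug1 mulr1 subrr. Qed.

(** Linearity over $A$ and not only over $k$, because the decomposition $f=f(\mathbf 1)\,e+$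
    [redl f] has its coefficient in $A$. *)
Lemma cprod_lmulDl D (c : A) f f' f'' g x : f = lmulA c f' + f'' ->
  cprod D f g x = c * cprod D f' g x + cprod D f'' g x.
Proof.
move=> ->; rewrite /cprod /= (tensorE (D x)) !linear_sum mulr_sumr -big_split /=.
by apply: eq_bigr => z _; rewrite !mtensE lin_addE /= mulrDl mulrA.
Qed.

Lemma cprod_lmulDr D (c : A) f g g' g'' x : g = lmulA c g' + g'' ->
  cprod D f g x = c * cprod D f g' x + cprod D f g'' x.
Proof.
move=> ->; rewrite /cprod /= (tensorE (D x)) !linear_sum mulr_sumr -big_split /=.
by apply: eq_bigr => z _; rewrite !mtensE lin_addE /= mulrDr mulrCA.
Qed.

Lemma cprod_linl D g : linear (fun f => cprod D f g).
Proof.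
move=> a f f'; apply: linear_ext => x; rewrite (@cprod_lmulDl _ (a%:A) _ f f').
  by rewrite lin_addE lin_scaleE mulr_algl.
by apply: linear_ext => y; rewrite !lin_addE lin_scaleE /= mulr_algl.
Qed.

Lemma cprod_linr D f : linear (cprod D f).
Proof.
move=> a g g'; apply: linear_ext => x; rewrite (@cprod_lmulDr _ (a%:A) _ _ g g').
  by rewrite lin_addE lin_scaleE mulr_algl.
by apply: linear_ext => y; rewrite !lin_addE lin_scaleE /= mulr_algl.
Qed.

Lemma cprodD_coprod D D' f g : cprod (D + D') f g = cprod D f g + cprod D' f g.
Proof. by apply: linear_ext => x; rewrite /cprod /= linearD. Qed.

(** Any mixed coassociativity law dualizes to an associativity law; the three half-shuffle relations
    and the associativity of [conv] are instances. *)
Lemma cprod_assoc D1 D2 D3 D4 f g h x :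
    tassoc _ _ _ (tmap D1 idfun (D2 x)) = tmap idfun D3 (D4 x) ->
  cprod D2 (cprod D1 f g) h x = cprod D4 f (cprod D3 g h) x.
Proof.
move=> D14; have idr (F : Lin) : (F \o idfun : Lin) = F by apply: linear_ext.
transitivity (mtens (mtens f g) h (tmap D1 idfun (D2 x))).
  by rewrite (mtens_comp (mtens f g) h D1 idfun) idr.
by rewrite -mtens_assoc D14 (mtens_comp f (mtens g h) idfun D3) idr.
Qed.

Lemma gb_pos_gr n x : x \in gb_gr H n.+1 -> gb_pos x.
Proof.
move=> xn; exists n.+1, (fun i => if i == n then x else 0); split.
  move=> i; case: eqP => [->//|_].
  by have [] := gr_submod (gb_grP H) i.+1.
rewrite big_ord_recr /= eqxx big1 ?add0r// => i _.
by rewrite ltn_eqF.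
Qed.

Lemma vanish1 f : f 1 = 0 -> vanish 1 f.
Proof.
by move=> f1 [|//] x _ /ub_connected[c ->]; rewrite linearZ_LR f1 scaler0.
Qed.

Lemma vanish_at1 n f : vanish n.+1 f -> f 1 = 0.
Proof. by move=> fn; apply: (fn 0%N); rewrite ?gr_one//; apply: gb_grP. Qed.

(** The axioms on the half-coproducts are stated on $B$ only; by connectedness the value at $\mathbf
    1$ is all that remains to be compared. *)
Lemma pos_ext f g : f 1 = g 1 -> (forall x, gb_pos x -> f x = g x) -> f = g.
Proof.
move=> fg1 fg; apply: (@lin_gr_ext _ H) => -[x /ub_connected[c ->]|n x /gb_pos_gr].
  by rewrite !linearZ_LR fg1.
exact: fg.
Qed.

Lemma mtens_bideg0 (Q : rel nat) f g t : tens_bideg (gb_gr H) Q t ->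
    (forall p q x y, Q p q -> x \in gb_gr H p -> y \in gb_gr H q -> f x * g y = 0) ->
  mtens f g t = 0.
Proof.
move=> [s [-> sP]] fg0; rewrite linear_sum big_seq big1// => z /sP[p [q [pq zp zq]]].
by rewrite mtensE (fg0 p q).
Qed.

Lemma mul_vanish0 a b p q f g x y : vanish a f -> vanish b g -> (p + q < a + b)%N ->
  x \in gb_gr H p -> y \in gb_gr H q -> f x * g y = 0.
Proof.
move=> fa gb pq xp yq; have [pa|ap] := ltnP p a; first by rewrite (fa p)// mul0r.
by rewrite (gb q) ?mulr0// -(ltn_add2l a) (leq_ltn_trans _ pq)// leq_add2r.
Qed.

Definition half_coproduct D : Prop := D 1 = 0 /\ forall n x, x \in gb_gr H n.+1 ->
  tens_bideg (gb_gr H) (fun p q => [&& 0 < p, 0 < q & p + q == n.+1])%N (D x).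

Lemma prec_half : half_coproduct (ub_prec H).
Proof. by split; [apply: ub_prec1 | apply: ub_prec_gr]. Qed.

Lemma succ_half : half_coproduct (ub_succ H).
Proof. by split; [apply: ub_succ1 | apply: ub_succ_gr]. Qed.

Lemma cprod1 D f g : half_coproduct D -> cprod D f g 1 = 0.
Proof. by move=> [D1 _]; rewrite /cprod /= D1 linear0. Qed.

Lemma aug_gr n x : x \in gb_gr H n.+1 -> e x = 0.
Proof. by move=> /gb_eps_gr; rewrite /= /aug_fun => ->; rewrite scale0r. Qed.

Lemma aug_pos x : gb_pos x -> e x = 0.
Proof.
move=> [n [s [sP ->]]]; rewrite linear_sum big1// => i _; exact: aug_gr (sP i).
Qed.

Lemma cprod_half0 D f g : half_coproduct D ->
  (forall p q x y, x \in gb_gr H p.+1 -> y \in gb_gr H q.+1 -> f x * g y = 0) -> cprod D f g = 0.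
Proof.
move=> hD fg0; apply: (@lin_gr_ext _ H) => -[x /ub_connected[c ->]|n x xn].
  by rewrite !linearZ_LR (cprod1 f g hD).
by apply: mtens_bideg0 (hD.2 _ _ xn) _ => -[|p] [|q] u v //= _; apply: fg0.
Qed.

Lemma cprod_augl D g : half_coproduct D -> cprod D e g = 0.
Proof. by move=> hD; apply: cprod_half0 => // p q x y /aug_gr -> _; rewrite mul0r. Qed.

Lemma cprod_augr D f : half_coproduct D -> cprod D f e = 0.
Proof. by move=> hD; apply: cprod_half0 => // p q x y _ /aug_gr ->; rewrite mulr0. Qed.

Lemma redl_decomp f : redl f = lmulA (- f 1) e + f.
Proof. by apply: linear_ext => x; rewrite lin_addE redlE /= mulNr addrC. Qed.

(** [f] and [redl f] differ by a multiple of $e$, which vanishes on the components of a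
    half-coproduct, all of positive degree. *)
Lemma cprod_redll D f g : half_coproduct D -> cprod D (redl f) g = cprod D f g.
Proof.
move=> hD; apply: linear_ext => x.
by rewrite (cprod_lmulDl _ _ _ (redl_decomp f)) cprod_augl// lin_zeroE mulr0 add0r.
Qed.

Lemma cprod_redlr D f g : half_coproduct D -> cprod D f (redl g) = cprod D f g.
Proof.
move=> hD; apply: linear_ext => x.
by rewrite (cprod_lmulDr _ _ _ (redl_decomp g)) cprod_augr// lin_zeroE mulr0 add0r.
Qed.

Lemma hprec_cprod f g : hprec f g = P f g + lmulA (g 1) (redl f).
Proof. by rewrite -(cprod_redll _ _ prec_half) -(cprod_redlr _ _ prec_half). Qed.

Lemma hsucc_cprod f g : hsucc f g = S f g + lmulA (f 1) (redl g).
Proof. by rewrite -(cprod_redll _ _ succ_half) -(cprod_redlr _ _ succ_half). Qed.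

Lemma hprec1 f g : hprec f g 1 = 0.
Proof. by rewrite hprec_cprod lin_addE (cprod1 _ _ prec_half) add0r lmulAE redl1 mulr0. Qed.

Lemma hsucc1 f g : hsucc f g 1 = 0.
Proof. by rewrite hsucc_cprod lin_addE (cprod1 _ _ succ_half) add0r lmulAE redl1 mulr0. Qed.

Lemma conv1 f g : conv f g 1 = f 1 * g 1.
Proof. by rewrite /conv /= gb_Delta1 mtensE. Qed.

(** On $B$ this is the splitting of the coproduct. The multiple of $e$ vanishes there and corrects
    the value at $\mathbf 1$, which the first two terms count twice. *)
Lemma convE f g : conv f g =
  lmulA (f 1) g + (lmulA (g 1) f + (lmulA (- (f 1 * g 1)) e + (P f g + S f g))).
Proof.
apply: pos_ext => [|x xB].
  rewrite conv1 !lin_addE (cprod1 _ _ prec_half) (cprod1 _ _ succ_half).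
  by rewrite !lmulAE aug1; ring.
have -> : conv f g x = P f g x + S f g x + f x * g 1 + f 1 * g x.
  by rewrite /conv /= ub_split// !linearD /= !mtensE.
by rewrite !lin_addE !lmulAE (aug_pos xB); ring.
Qed.

Lemma precprec f g h : P (P f g) h = P f (P g h + S g h).
Proof.
apply: pos_ext => [|x xB]; first by rewrite !cprod1//; apply: prec_half.
by rewrite -cprodD_coprod; apply/cprod_assoc/ub_precprec.
Qed.

Lemma succprec f g h : P (S f g) h = S f (P g h).
Proof.
apply: pos_ext => [|x xB]; last exact/cprod_assoc/ub_succprec.
by rewrite (cprod1 _ _ prec_half) (cprod1 _ _ succ_half).
Qed.

Lemma succsucc f g h : S (P f g + S f g) h = S f (S g h).
Proof.
apply: pos_ext => [|x xB]; first by rewrite !cprod1//; apply: succ_half.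
by rewrite -cprodD_coprod; apply/cprod_assoc/ub_succsucc.
Qed.

End HalfShuffles.

(** * Half-shuffle relations extended to maps with arbitrary value at $\mathbf 1$ *)

Section HalfShuffleIdentities.
Context (k : fieldType) (H : unshuffleBialgebra k) (A : comAlgType k).
Notation Lin := {linear H -> A}.
Notation e := (aug H A).
Implicit Types (f g h : Lin) (D : {linear H -> tensor H H}).
Local Notation P := (cprod (ub_prec H)).
Local Notation S := (cprod (ub_succ H)).

Let linE := (@lin_addE, @lin_oppE, @lin_scaleE, @lmulAE, @redlE).

Lemma conv_assoc f g h : conv (conv f g) h = conv f (conv g h).
Proof. by apply: linear_ext => x; apply/cprod_assoc/gb_coassoc. Qed.

Lemma conv_augl f : conv e f = f.
Proof.
apply: linear_ext => x; rewrite convE (cprod_augl _ (prec_half H)) (cprod_augl _ (succ_half H)).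
by rewrite aug1 !linE !lin_zeroE; ring.
Qed.

Lemma conv_augr f : conv f e = f.
Proof.
apply: linear_ext => x; rewrite convE (cprod_augr _ (prec_half H)) (cprod_augr _ (succ_half H)).
by rewrite aug1 !linE !lin_zeroE; ring.
Qed.

Lemma hprec_id f g : f 1 = 0 -> hprec f g = P f g + lmulA (g 1) f.
Proof. by move=> f1; rewrite hprec_cprod redl_id. Qed.

Lemma hsucc_id f g : g 1 = 0 -> hsucc f g = S f g + lmulA (f 1) g.
Proof. by move=> g1; rewrite hsucc_cprod redl_id. Qed.

Lemma cprod_lmull D c f g : cprod D (lmulA c f) g = lmulA c (cprod D f g).
Proof.
apply: linear_ext => x; rewrite (@cprod_lmulDl _ _ _ _ c _ f 0); last first.
  by apply: linear_ext => y; rewrite !linE lin_zeroE addr0.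
by rewrite /cprod mtens0l lmulAE /= addr0.
Qed.

Lemma cprod_lmulr D c f g : cprod D f (lmulA c g) = lmulA c (cprod D f g).
Proof.
apply: linear_ext => x; rewrite (@cprod_lmulDr _ _ _ _ c _ _ g 0); last first.
  by apply: linear_ext => y; rewrite !linE lin_zeroE addr0.
by rewrite /cprod mtens0r lmulAE /= addr0.
Qed.

Lemma cprodDl D f f' g : cprod D (f + f') g = cprod D f g + cprod D f' g.
Proof. by have := cprod_linl D g 1 f f'; rewrite !scale1r. Qed.

Lemma cprodDr D f g g' : cprod D f (g + g') = cprod D f g + cprod D f g'.
Proof. by have := cprod_linr D f 1 g g'; rewrite !scale1r. Qed.

Let cprodE := (cprodDl, cprodDr, cprod_lmull, cprod_lmulr).

(** Convolution acts from the right on $\mathrm{Lin}(B,A)$ through $\prec$. The terms of [convE]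
    carrying $g(\mathbf 1)$ and $h(\mathbf 1)$ match the extension rules, so $g$ and $h$ may be
    characters. *)
Lemma hprec_hprec f g h : f 1 = 0 -> hprec (hprec f g) h = hprec f (conv g h).
Proof.
move=> f1; rewrite (hprec_id _ (hprec1 f g)) !hprec_id// convE !cprodE precprec.
rewrite (cprod_augr _ (prec_half H)) !cprodE; apply: linear_ext => x.
rewrite !linE lin_zeroE aug1 !(cprod1 _ _ (prec_half H)) (cprod1 _ _ (succ_half H)); ring.
Qed.

Lemma hprec_hsucc f g h : g 1 = 0 -> hprec (hsucc f g) h = hsucc f (hprec g h).
Proof.
move=> g1; rewrite (hprec_id _ (hsucc1 f g)) (hsucc_id _ (hprec1 g h)).
rewrite hprec_id// hsucc_id// !cprodE succprec.
by apply: linear_ext => x; rewrite !linE; ring.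
Qed.

Lemma hsucc_conv f g h : h 1 = 0 -> hsucc (conv f g) h = hsucc f (hsucc g h).
Proof.
move=> h1; rewrite (hsucc_id _ (hsucc1 g h)) !hsucc_id// conv1 convE !cprodE -succsucc.
rewrite (cprod_augl _ (succ_half H)) !cprodE; apply: linear_ext => x.
by rewrite !linE lin_zeroE; ring.
Qed.

Lemma conv_split f g : f 1 = 0 -> conv f g = hprec f g + hsucc f g.
Proof.
move=> f1; rewrite hprec_id// hsucc_cprod convE f1; apply: linear_ext => x.
by rewrite !linE; ring.
Qed.

(* moves scalars of k into A, where [ring] can treat them *)
Let scale_mul (a : k) (y : A) : a *: y = in_alg A a * y.
Proof. by rewrite mulr_algl. Qed.

Lemma redl_linear : linear (@redl k H A).
Proof.
by move=> a f g; apply: linear_ext => x; rewrite !linE !(scale_mul a); ring.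
Qed.

Lemma hprec_linl g : linear (fun f => hprec f g).
Proof.
move=> a f f'; rewrite !hprec_cprod cprod_linl redl_linear; apply: linear_ext => x.
by rewrite !linE !(scale_mul a); ring.
Qed.

Lemma hprec_linr f : linear (hprec f).
Proof.
move=> a g g'; rewrite !hprec_cprod cprod_linr; apply: linear_ext => x.
by rewrite !linE !(scale_mul a); ring.
Qed.

Lemma hsucc_linl g : linear (fun f => hsucc f g).
Proof.
move=> a f f'; rewrite !hsucc_cprod cprod_linl; apply: linear_ext => x.
by rewrite !linE !(scale_mul a); ring.
Qed.

Lemma hsucc_linr f : linear (hsucc f).
Proof.
move=> a g g'; rewrite !hsucc_cprod cprod_linr redl_linear; apply: linear_ext => x.
by rewrite !linE !(scale_mul a); ring.
Qed.

Lemma conv_linl g : linear (fun f => conv f g).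
Proof. exact: cprod_linl. Qed.

Lemma conv_linr f : linear (conv f).
Proof. exact: cprod_linr. Qed.

Lemma prelie_linr f : linear (prelie f).
Proof.
move=> a g g'; rewrite /prelie hsucc_linr hprec_linl scalerBr; rewrite opprD.
by rewrite addrACA.
Qed.

Lemma prelie_linl g : linear (fun f => prelie f g).
Proof.
move=> a f f'; rewrite /prelie hsucc_linl hprec_linr scalerBr; rewrite opprD.
by rewrite addrACA.
Qed.

(** * Compatibility of the products with the degree filtration *)

Lemma vanish_half D a b f g :
  half_coproduct D -> vanish a f -> vanish b g -> vanish (a + b) (cprod D f g).
Proof.
move=> hD fa gb [x _ /ub_connected[c ->]|n x nab xn].
  by rewrite linearZ_LR (cprod1 f g hD) scaler0.
apply: mtens_bideg0 (hD.2 _ _ xn) _ => p q u v /and3P[_ _ /eqP pq] up vq.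
by apply: (mul_vanish0 fa gb _ up vq); rewrite pq.
Qed.

Lemma vanish_lmulA n c f : vanish n f -> vanish n (lmulA c f).
Proof. by move=> fn i x xn xi; rewrite lmulAE (fn i)// mulr0. Qed.

Lemma vanish_redl n f : vanish n f -> vanish n (redl f).
Proof. by case: n => [//|n] fn; rewrite redl_id//; apply: vanish_at1 fn. Qed.

Lemma vanish_lmulA1 a b f g : vanish a f -> vanish b g -> vanish (a + b) (lmulA (g 1) (redl f)).
Proof.
case: b => [|b] fa gb; first by rewrite addn0; apply/vanish_lmulA/vanish_redl.
by rewrite (vanish_at1 gb) => i x _ _; rewrite lmulAE mul0r.
Qed.

Lemma vanish_hprec a b f g : vanish a f -> vanish b g -> vanish (a + b) (hprec f g).
Proof.
move=> fa gb; rewrite hprec_cprod; apply: vanishD; last exact: vanish_lmulA1.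
by apply: vanish_half => //; apply: prec_half.
Qed.

Lemma vanish_hsucc a b f g : vanish a f -> vanish b g -> vanish (a + b) (hsucc f g).
Proof.
move=> fa gb; rewrite hsucc_cprod; apply: vanishD; last by rewrite addnC; apply: vanish_lmulA1.
by apply: vanish_half => //; apply: succ_half.
Qed.

Lemma vanish_prelie a b f g : vanish a f -> vanish b g -> vanish (a + b) (prelie f g).
Proof.
by move=> fa gb; apply: vanishB; [apply: vanish_hsucc | rewrite addnC; apply: vanish_hprec].
Qed.

Lemma vanish_conv a b f g : vanish a f -> vanish b g -> vanish (a + b) (conv f g).
Proof.
move=> fa gb n x nab xn; apply: mtens_bideg0 (gb_Delta_gr xn) _ => p q u v /eqP pq up vq.
by apply: (mul_vanish0 fa gb _ up vq); rewrite pq.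
Qed.

End HalfShuffleIdentities.

(** * Half-shuffle exponential and group law *)

Section GroupLaw.
Context (k : fieldType) (H : unshuffleBialgebra k) (A : comAlgType k).
Notation Lin := {linear H -> A}.
Notation e := (aug H A).
Implicit Types (f g h X : Lin).

(** Geometric series: with $d=e-f$, which raises degree, the inverse is the fixed point of $g\mapsto
    e+d*g$. *)
Lemma conv_rinv f : f 1 = 1 -> exists g, conv f g = e.
Proof.
move=> f1; pose d := e - f.
have d1 : vanish 1 d by apply: vanish1; rewrite lin_addE lin_oppE f1 aug1 subrr.
have [n g g' gg'|g gE _] := @contraction_fixpoint _ H A (fun g => e + conv d g).
  rewrite opprD addrACA subrr add0r -scaleN1r addrC -conv_linr.
  by rewrite scaleN1r addrC; apply: (vanish_conv d1 gg').
exists g; have -> : f = - d + e by rewrite opprB subrK.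
have := conv_linl g (-1) d e; rewrite !scaleN1r => ->.
by rewrite conv_augl {2}gE addrC addrK.
Qed.

Lemma conv_inv_unique f g : conv f g = e -> conv g f = e -> conv_inv f = g.
Proof.
move=> fg gf; apply: (xget_unique 0) => // h [fh hf].
by rewrite -[h]conv_augr -fg -conv_assoc hf conv_augl.
Qed.

(** A right inverse of $f$ takes the value $1$ at $\mathbf 1$, so it has a right inverse in turn,
    which must be $f$. *)
Lemma conv_invP f : f 1 = 1 -> conv f (conv_inv f) = e /\ conv (conv_inv f) f = e.
Proof.
move=> f1; suff [g fg] : exists g, conv f g = e /\ conv g f = e.
  by apply: (xgetPex 0 (P := [set g : Lin | conv f g = e /\ conv g f = e]%classic)); exists g.
have [g fg] := conv_rinv f1.
have g1 : g 1 = 1 by rewrite -[LHS]mul1r -f1 -conv1 fg aug1.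
have [f' gf'] := conv_rinv g1.
exists g; split=> //; suff -> : f = f' by [].
by rewrite -[f]conv_augr -gf' -conv_assoc fg conv_augl.
Qed.

Lemma conv_invK f : f 1 = 1 -> conv_inv (conv_inv f) = f.
Proof. by move=> /conv_invP[fg gf]; apply: conv_inv_unique. Qed.

(** $(f-e)\prec f^{-1}=(g\prec f)\prec f^{-1}=g\prec(f*f^{-1})=g$. Computing a logarithm thus
    amounts to checking a fixed point equation. *)
Lemma logprecE f g : f 1 = 1 -> g 1 = 0 -> f = e + hprec g f -> logprec f = g.
Proof.
move=> f1 g1 fE; have [ff' _] := conv_invP f1; rewrite /logprec {1}fE.
by rewrite addrAC subrr add0r hprec_hprec// ff' hprec_aug.
Qed.

Lemma hprec_fix_contract g n f f' : g 1 = 0 -> vanish n (f - f') ->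
  vanish n.+1 ((e + hprec g f) - (e + hprec g f')).
Proof.
move=> g1 ff'; rewrite opprD addrACA subrr add0r -scaleN1r addrC -hprec_linr.
by rewrite scaleN1r addrC; apply: (vanish_hprec (vanish1 g1) ff').
Qed.

(** Applying $g\prec-$ shifts the series by one; its first term comes from $g\prec e=g$. *)
Lemma Eprec_fix g : g 1 = 0 -> Eprec g = e + hprec g (Eprec g).
Proof.
move=> g1; pose F n := iter n (hprec g) g.
have vF n : vanish n.+1 (F n).
  by elim: n => [|n IH] /=; [apply: vanish1 | apply: (vanish_hprec (vanish1 g1) IH)].
have sF : summable F by move=> n; apply: vanish_le (vF n).
have := hprec_linr g 1 e (lsum F); rewrite !scale1r /Eprec => ->; congr (_ + _).
rewrite hprec_aug// [LHS](lsum_recl sF); congr (_ + _).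
rewrite (lsum_linear (hprec_linr g))// => n f fn; apply: (vanish_hprec (vanishT g) fn).
Qed.

Lemma Eprec_unique g f : g 1 = 0 -> f = e + hprec g f -> f = Eprec g.
Proof.
move=> g1 fE.
have [n f1 f2|h _ hu] := @contraction_fixpoint _ H A (fun f => e + hprec g f).
  exact: hprec_fix_contract.
by rewrite (hu f fE) (hu _ (Eprec_fix g1)).
Qed.

Lemma Eprec1 g : g 1 = 0 -> Eprec g 1 = 1.
Proof. by move=> /Eprec_fix ->; rewrite lin_addE hprec1 addr0 aug1. Qed.

Lemma Ad1 f g : Ad f g 1 = 0. Proof. exact: hprec1. Qed.

Lemma lshuffle_Ad g1 g2 : g1 1 = 0 -> g2 1 = 0 ->
  lshuffle g1 g2 = g1 + Ad (conv_inv (Eprec g1)) g2.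
Proof.
move=> g10 g20; set f1 := Eprec g1; set f2 := Eprec g2.
have f11 : f1 1 = 1 := Eprec1 g10; have f21 : f2 1 = 1 := Eprec1 g20.
have f1E : hprec g1 f1 = f1 - e by rewrite {2}/f1 Eprec_fix// addrAC subrr add0r.
have f2E : hprec g2 f2 = f2 - e by rewrite {2}/f2 Eprec_fix// addrAC subrr add0r.
have d1 : (f1 - e) 1 = 0 by rewrite lin_addE lin_oppE f11 aug1 subrr.
have d2 : (f2 - e) 1 = 0 by rewrite lin_addE lin_oppE f21 aug1 subrr.
have [_ inv1] := conv_invP f11.
apply: logprecE; first by rewrite conv1 f11 f21 mulr1.
  by rewrite lin_addE g10 add0r; apply: Ad1.
have := hprec_linl (conv f1 f2) 1 g1 (Ad (conv_inv f1) g2); rewrite !scale1r => ->.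
(* First summand: $\gamma_1\prec(F_1*F_2)=(\gamma_1\prec F_1)\prec F_2=(F_1-e)\prec F_2$. *)
rewrite -hprec_hprec// f1E /Ad conv_invK// hprec_hprec ?hsucc1//.
(* Second summand: $F_1^{-1}$ cancels against $F_1*F_2$, leaving $F_1\succ(\gamma_2\prec
   F_2)=F_1\succ(F_2-e)$. *)
rewrite -conv_assoc inv1 conv_augl hprec_hsucc// f2E.
have -> : conv f1 f2 = conv (f1 - e) f2 + f2.
  by have := conv_linl f2 1 (f1 - e) e; rewrite !scale1r subrK conv_augl.
rewrite conv_split//.
have -> : hsucc f1 (f2 - e) = hsucc (f1 - e) f2 + (f2 - e).
  have := hsucc_linl (f2 - e) 1 (f1 - e) e; rewrite !scale1r subrK => ->.
  rewrite aug_hsucc//; congr (_ + _).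
  have := hsucc_linr (f1 - e) (-1) e f2; rewrite !scaleN1r [- e + f2]addrC => ->.
  by rewrite hsucc_aug// oppr0 add0r.
by rewrite !addrA [RHS]addrC !addrA addNr add0r.
Qed.

End GroupLaw.

(** * Pre-Lie Magnus expansion *)

Section OrderedBinomial.
Context (k : fieldType) (V : lmodType k) (rho L : V -> V).
Hypotheses (rho_lin : linear rho) (L_lin : linear L).
Hypothesis rhoL : forall v, rho (L v) = L (rho v).

Local Notation t v a b := (iter a rho (iter b L v)).

Lemma iter_comm n v : iter n rho (L v) = L (iter n rho v).
Proof. by elim: n => //= n ->. Qed.

(** Pascal's rule for arbitrary coefficients. [iter_addE] uses it with [c n.+1] zero; for the
    convolution powers of $X$ the boundary term is the summand $X\prec X^{*n}$, with coefficient
    1. *)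
Lemma ordered_step (c : nat -> nat) n v :
  rho (\sum_(a < n.+1) (c a)%:R *: t v a (n - a)%N) +
    L (\sum_(a < n.+1) (c a)%:R *: t v a (n - a)%N) + (c n.+1)%:R *: t v n.+1 0 =
  \sum_(a < n.+2) (c a + (if a : nat is b.+1 then c b else 0))%:R *: t v a (n.+1 - a)%N.
Proof.
pose R' : {linear V -> V} := HB.pack rho (GRing.isLinear.Build k V V *:%R rho rho_lin).
pose L' : {linear V -> V} := HB.pack L (GRing.isLinear.Build k V V *:%R L L_lin).
have RZ c' x : rho (c' *: x) = c' *: rho x by exact: (linearZ_LR R').
have LZ c' x : L (c' *: x) = c' *: L x by exact: (linearZ_LR L').
rewrite -[rho _]/(R' _) -[L (\sum_(_ < _) _)]/(L' _) !linear_sum /=.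
under [RHS]eq_bigr do rewrite natrD scalerDl.
rewrite [RHS]big_split /= [X in _ = X + _]big_ord_recr [X in _ = _ + X]big_ord_recl /=.
rewrite scale0r add0r subnn -addrA addrC; congr (_ + _ + _).
  apply: eq_bigr => a _; rewrite LZ -iter_comm subSn//.
  by rewrite -ltnS.
by apply: eq_bigr => a _; rewrite RZ.
Qed.

Lemma iter_addE (lam : V -> V) n v : (forall w, lam w = rho w + L w) ->
  iter n lam v = \sum_(a < n.+1) 'C(n, a)%:R *: t v a (n - a)%N.
Proof.
move=> lamE; elim: n => [|n IH]; first by rewrite big_ord1 bin0 scale1r.
rewrite iterS; have := ordered_step (fun a => 'C(n, a)) n v;
rewrite bin_small// scale0r addr0 -IH -lamE => ->.
by apply: eq_bigr => -[[|a] ?] _ /=; rewrite ?bin0 ?binS// addnC.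
Qed.

End OrderedBinomial.

(** * Bernoulli numbers, the Magnus fixed point and the convolution exponential *)

Section MagnusExpansion.
Context (k : fieldType) (k0 : [pchar k] =i pred0).
Context (H : unshuffleBialgebra k) (A : comAlgType k).
Notation Lin := {linear H -> A}.
Notation e := (aug H A).
Implicit Types (f g h X Y : Lin).

Lemma inv_fact_bin n m : (m <= n)%N ->
  (n`!%:R)^-1 * 'C(n, m)%:R = (m`!%:R)^-1 * ((n - m)`!%:R)^-1 :> k.
Proof.
move=> mn; rewrite -(bin_fact mn) -invfM -natrM natrM invfM mulrAC mulVf ?mul1r//.
by move/pcharf0P: k0 => ->; rewrite -lt0n bin_gt0.
Qed.

(** Coefficientwise form of $\frac{\mathrm e^x-1}{x}\cdot\frac{x}{\mathrm e^x-1}=1$; a factor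
    $1/(n+1)!$ apart, it is the recurrence of the Bernoulli numbers. *)
Lemma bernoulli_inverse n :
  \sum_(i < n.+1) (i.+1`!%:R)^-1 * (bernoulli k (n - i) / (n - i)`!%:R) = (n == 0)%:R.
Proof.
rewrite (reindex_inj rev_ord_inj) /=.
transitivity ((n.+1`!%:R)^-1 * \sum_(j < n.+1) 'C(n.+1, j)%:R * bernoulli k j).
  rewrite mulr_sumr; apply: eq_bigr => j _; rewrite subSS.
  have jn : (j <= n)%N by rewrite -ltnS.
  by rewrite subKn// [RHS]mulrA inv_fact_bin ?(leqW jn)// subSn//; ring.
by rewrite bernoulliE//; case: n => [|n]; rewrite ?mulr0// mulr1 invr1.
Qed.

Lemma linear_scale (T : Lin -> Lin) (c : k) f : linear T -> T (c *: f) = c *: T f.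
Proof. by move=> Tl; apply: (GRing.scalable_linear Tl). Qed.

Lemma iter_linear (T : Lin -> Lin) n : linear T -> linear (iter n T).
Proof. by move=> Tl a f g; elim: n => //= n ->; rewrite Tl. Qed.

Lemma vanish_iter (T : Lin -> Lin) n m f :
  (forall m f, vanish m f -> vanish m.+1 (T f)) -> vanish m f -> vanish (n + m) (iter n T f).
Proof. by move=> Tv fm; elim: n => [//|n IH]; apply: Tv. Qed.

Lemma vanish_prelie1 X n f : X 1 = 0 -> vanish n f -> vanish n.+1 (prelie X f).
Proof. by move=> X1 fn; apply: (vanish_prelie (vanish1 X1) fn). Qed.

Definition magnus_map g X : Lin :=
  lsum (fun m => (bernoulli k m / m`!%:R) *: iter m (prelie X) g).

Lemma summable_prelie (c : nat -> k) X g : X 1 = 0 ->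
  summable (fun m => c m *: iter m (prelie X) g).
Proof.
move=> X1 m; apply: vanishZ; rewrite -[X in vanish X _]addn0; apply: vanish_iter => //.
by move=> p f; apply: vanish_prelie1.
Qed.

Lemma magnus_contract g n X Y : g 1 = 0 -> X 1 = 0 -> Y 1 = 0 -> vanish n (X - Y) ->
  vanish n.+1 (magnus_map g X - magnus_map g Y).
Proof.
move=> g1 X1 Y1 XY; rewrite lsumB; try exact: summable_prelie.
apply: vanish_lsum => [m|m].
  by apply: vanishB; apply: (summable_prelie (fun m => bernoulli k m / m`!%:R)).
rewrite -scalerBr; apply: vanishZ; elim: m => [|m IH] /=; first by rewrite subrr.
(* $L_X^{m+1}g-L_Y^{m+1}g=L_{X-Y}L_X^mg+L_Y(L_X^mg-L_Y^mg)$. The first term gains a degree because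
   $L_X^mg$ vanishes in degree 0, the second is handled by induction. *)
apply: (@vanish_trans _ _ _ _ _ (prelie Y (iter m (prelie X) g))).
  have -> : forall u, prelie X u - prelie Y u = prelie (X - Y) u.
    by move=> u; have := prelie_linl u (-1) Y X; rewrite !scaleN1r ![- _ + _]addrC => ->.
  rewrite -addn1; apply: vanish_prelie => //.
  apply: (@vanish_le _ _ _ _ (m + 1)); first by rewrite addn1.
  by apply: vanish_iter; [move=> ? ?; apply: vanish_prelie1 | apply: vanish1].
have -> : forall u v, prelie Y u - prelie Y v = prelie Y (u - v).
  by move=> u v; have := prelie_linr Y (-1) v u; rewrite !scaleN1r ![- _ + _]addrC => ->.
by apply: (vanish_prelie (vanishT Y)).
Qed.

Lemma vanish_iter_prelie X n m f : X 1 = 0 -> vanish m f ->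
  vanish (n + m) (iter n (prelie X) f).
Proof. by move=> X1; apply: vanish_iter => ? ?; apply: vanish_prelie1. Qed.

Lemma vanish_iter_prelie0 X n f : X 1 = 0 -> vanish n (iter n (prelie X) f).
Proof. by move=> X1; rewrite -[X in vanish X _]addn0; apply: vanish_iter_prelie. Qed.

Lemma lsum_prelie1 (c : nat -> k) X g : g 1 = 0 -> X 1 = 0 ->
  lsum (fun m => c m *: iter m (prelie X) g) 1 = 0.
Proof.
move=> g1 X1; apply: (@vanish_at1 _ _ _ 0); apply: vanish_lsum => [|m].
  exact: summable_prelie.
apply: vanishZ; apply: (@vanish_le _ _ _ _ (m + 1)); first by rewrite addn1.
by apply: vanish_iter_prelie => //; apply: vanish1.
Qed.

Lemma magnus_eq_Omega' g : g 1 = 0 -> magnus_eq g (Omega' g).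
Proof.
move=> g1.
(* [magnus_contract] needs arguments that vanish at $\mathbf 1$; composing with [redl] gives a
   contraction on all maps, with the same fixed points. *)
have [n X Y XY|X XE Xu] := @contraction_fixpoint _ H A (fun X => magnus_map g (redl X)).
  apply: magnus_contract; rewrite ?redl1//.
  have := redl_linear (-1) Y X; rewrite !scaleN1r ![- _ + _]addrC => <-.
  exact: vanish_redl.
have X1 : X 1 = 0 by rewrite XE /magnus_map lsum_prelie1 ?redl1.
(* Existence and uniqueness exclude the default value of [xget]. *)
suff [] : [set X : Lin | magnus_eq g X /\ forall Y, magnus_eq g Y -> Y = X]%classic (Omega' g).
  by [].
apply: (xgetPex 0); exists X; split=> [|Y [Y1 YE]].
  by split=> //; rewrite {1}XE redl_id.
by apply: Xu; rewrite redl_id.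
Qed.

Lemma lsum_prelie_iter (c : nat -> k) X g n : X 1 = 0 ->
  iter n (prelie X) (lsum (fun m => c m *: iter m (prelie X) g)) =
  lsum (fun m => c m *: iter (n + m) (prelie X) g).
Proof.
move=> X1; have Ll := iter_linear n (prelie_linr X).
rewrite (lsum_linear Ll); last exact: summable_prelie; last first.
  move=> m f fm; apply: (@vanish_le _ _ _ _ (n + m)); first exact: leq_addl.
  by apply: vanish_iter => // ? ?; apply: vanish_prelie1.
by apply: eq_lsum => m; rewrite (linear_scale _ _ Ll) iterD.
Qed.

Lemma summable_prelie_shift (c : nat -> k) X g n : X 1 = 0 ->
  summable (fun m => c m *: iter (n + m) (prelie X) g).
Proof.
move=> X1 m; apply: vanishZ; apply: (@vanish_le _ _ _ _ (n + m)); first exact: leq_addl.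
exact: vanish_iter_prelie0.
Qed.

(** With $L=L_{X\rhd}$, the equation $X=\frac{L}{\mathrm e^L-1}(g)$ is solved for $g$: substituting
    it into the series yields a double series whose antidiagonal sums are given by
    [bernoulli_inverse]. *)
Lemma magnus_inverse g X : magnus_eq g X ->
  g = lsum (fun n => (n.+1`!%:R)^-1 *: iter n (prelie X) X).
Proof.
move=> [X1 XE].
pose F n m := ((n.+1`!%:R)^-1 * (bernoulli k m / m`!%:R)) *: iter (n + m) (prelie X) g.
have -> : (fun n => (n.+1`!%:R)^-1 *: iter n (prelie X) X) = (fun n => lsum (F n)).
  apply: funext => n; rewrite {2}XE lsum_prelie_iter// lsumZ; last first.
    exact: summable_prelie_shift.
  by apply: eq_lsum => m; rewrite scalerA.
rewrite lsum_double => [|i m]; last by apply: vanishZ; apply: vanish_iter_prelie0.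
have -> : (fun n => \sum_(i < n.+1) F i (n - i)%N) =
          (fun n => (n == 0)%:R *: iter n (prelie X) g).
  apply: funext => n; rewrite -bernoulli_inverse scaler_suml.
  by apply: eq_bigr => i _; rewrite /F subnKC// -ltnS.
apply: lsum_unique => [|[//|n]]; first exact: summable_prelie.
rewrite big_ord_recl scale1r big1 ?addr0 ?subrr// => i _.
by rewrite scale0r.
Qed.

Definition exp_conv X : Lin := lsum (fun n => (n`!%:R)^-1 *: iter n (conv X) e).

Lemma summable_exp_conv X : X 1 = 0 -> summable (fun n => (n`!%:R)^-1 *: iter n (conv X) e).
Proof.
move=> X1 n; apply: vanishZ; rewrite -[X in vanish X _]addn0; apply: vanish_iter => // m f.
exact: (vanish_conv (vanish1 X1)).
Qed.

Lemma hprec_conv_iter X n f : f 1 = 0 ->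
  hprec f (iter n (conv X) e) = iter n (fun f => hprec f X) f.
Proof.
move=> f1; elim: n f f1 => [|n IH] f f1; first exact: hprec_aug.
by rewrite iterS -hprec_hprec// IH ?hprec1// iterSr.
Qed.

Lemma hsucc_conv_iter X n f : f 1 = 0 ->
  hsucc (iter n (conv X) e) f = iter n (hsucc X) f.
Proof.
move=> f1; elim: n => [|n IH]; first exact: aug_hsucc.
by rewrite !iterS hsucc_conv// IH.
Qed.

(** $L_{X\rhd}$ is $X\succ-$ minus $-\prec X$, and $-\prec X$ commutes with both. *)
Lemma hprec_prelieC X f : hprec (prelie X f) X = prelie X (hprec f X).
Proof.
have EX : hprec (hsucc X f) X = hsucc X (hprec f X).
  (* For arbitrary $f$ both products depend on [redl f] only, to which [hprec_hsucc] applies. *)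
  have -> : hsucc X f = hsucc X (redl f) by rewrite /hsucc (redl_id (redl1 f)).
  have -> : hprec f X = hprec (redl f) X by rewrite /hprec (redl_id (redl1 f)).
  by rewrite hprec_hsucc// redl1.
have := hprec_linl X (-1) (hprec f X) (hsucc X f).
by rewrite !scaleN1r ![- _ + _]addrC /prelie EX.
Qed.

Lemma hsucc_prelie X f : hsucc X f = hprec f X + prelie X f.
Proof. by rewrite /prelie addrC subrK. Qed.

(** Induction on $X*Y=X\prec Y+X\succ Y$ with $Y$ a power of $X$: the first part is a pure power of
    $\rho=(-\prec X)$ applied to $X$, the second is $(\rho+L)(Y)$. *)
Lemma conv_iter_expand X n : X 1 = 0 -> iter n.+1 (conv X) e =
  \sum_(a < n.+1) 'C(n.+1, a)%:R *: iter a (fun f => hprec f X) (iter (n - a) (prelie X) X).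
Proof.
move=> X1; elim: n => [|n IH]; first by rewrite big_ord1 bin0 scale1r /= conv_augr.
rewrite iterS conv_split// hprec_conv_iter// hsucc_prelie {}IH addrC.
have := ordered_step (hprec_linl X) (prelie_linr X) (hprec_prelieC X)
  (fun a => 'C(n.+1, a)) n X.
rewrite binn scale1r => ->.
by apply: eq_bigr => -[[|a] ?] _ /=; rewrite ?bin0 ?binS// addnC.
Qed.

Lemma hprec_exp_conv X f : X 1 = 0 -> f 1 = 0 ->
  hprec f (exp_conv X) = lsum (fun n => (n`!%:R)^-1 *: iter n (fun f => hprec f X) f).
Proof.
move=> X1 f1; rewrite (lsum_linear (hprec_linr f)); last exact: summable_exp_conv; last first.
  by move=> n g; apply: (vanish_hprec (vanishT f)).
by apply: eq_lsum => n; rewrite (linear_scale _ _ (hprec_linr f)) hprec_conv_iter.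
Qed.

Lemma vanish_iter_hprec X n m f : X 1 = 0 -> vanish m f ->
  vanish (n + m) (iter n (fun f => hprec f X) f).
Proof.
move=> X1; apply: vanish_iter => {}m {}f fm; rewrite -addn1.
exact: (vanish_hprec fm (vanish1 X1)).
Qed.

(** The coefficients are left free to serve twice: $1/(m+1)!$ with $f=X$, where the series is
    $\gamma_1$, and $1/m!$, where it is $\mathrm e^{L}(f)$. *)
Lemma hprec_lsum_exp_conv (c : nat -> k) X f : X 1 = 0 -> f 1 = 0 ->
  hprec (lsum (fun n => c n *: iter n (prelie X) f)) (exp_conv X) =
  lsum (fun n => \sum_(a < n.+1) ((a`!%:R)^-1 * c (n - a)%N) *:
    iter a (fun f => hprec f X) (iter (n - a) (prelie X) f)).
Proof.
move=> X1 f1; rewrite hprec_exp_conv// ?lsum_prelie1//.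
pose F a b := ((a`!%:R)^-1 * c b) *: iter a (fun f => hprec f X) (iter b (prelie X) f).
rewrite -[RHS]/(lsum (fun n => \sum_(a < n.+1) F a (n - a)%N)) -lsum_double; last first.
  by move=> a b; apply/vanishZ/vanish_iter_hprec => //; apply: vanish_iter_prelie0.
apply: eq_lsum => a; have rl := iter_linear a (hprec_linl X).
rewrite (lsum_linear rl); last exact: summable_prelie; last first.
  move=> n g gn; apply: (@vanish_le _ _ _ _ (a + n)); first exact: leq_addl.
  exact: vanish_iter_hprec.
rewrite lsumZ; first by apply: eq_lsum => b; rewrite (linear_scale _ _ rl) scalerA.
move=> b; rewrite (linear_scale _ _ rl); apply: vanishZ.
apply: (@vanish_le _ _ _ _ (a + b)); first exact: leq_addl.
by apply: vanish_iter_hprec => //; apply: vanish_iter_prelie0.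
Qed.

Lemma exp_conv_Omega' g : g 1 = 0 -> exp_conv (Omega' g) = Eprec g.
Proof.
move=> g1; have gX := magnus_eq_Omega' g1; move: (Omega' g) gX => X gX.
have X1 := gX.1; apply: Eprec_unique => //.
rewrite [in RHS](magnus_inverse gX) hprec_lsum_exp_conv// /exp_conv.
rewrite (lsum_recl (summable_exp_conv X1)).
rewrite fact0 invr1 scale1r; congr (_ + _); apply: eq_lsum => n.
rewrite conv_iter_expand// scaler_sumr; apply: eq_bigr => a _.
have an : (a <= n)%N by rewrite -ltnS.
(* The coefficient $\binom{n+1}{a}/(n+1)!$ splits as $\frac1{a!}\cdot\frac1{(n-a+1)!}$, the second
   factor being that of [magnus_inverse]. *)
by rewrite scalerA inv_fact_bin ?subSn// leqW.
Qed.

Lemma hprec_exp_prelie X g : X 1 = 0 -> g 1 = 0 ->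
  hprec (exp_prelie X g) (exp_conv X) = hsucc (exp_conv X) g.
Proof.
move=> X1 g1; rewrite hprec_lsum_exp_conv//.
rewrite (lsum_linear (hsucc_linl g)); last exact: summable_exp_conv; last first.
  by move=> n f fn; rewrite -[n]addn0; apply: (vanish_hsucc fn (vanishT g)).
apply: eq_lsum => n; rewrite (linear_scale _ _ (hsucc_linl g)) hsucc_conv_iter//.
rewrite (iter_addE (hprec_linl X) (prelie_linr X) (hprec_prelieC X) _ _ (hsucc_prelie X)).
rewrite scaler_sumr; apply: eq_bigr => a _; rewrite scalerA inv_fact_bin//.
by rewrite -ltnS.
Qed.

(** $F_1\succ\gamma_2=\mathrm e^L(\gamma_2)\prec F_1$, and $-\prec F_1^{-1}$ undoes the right-hand
    factor. *)
Lemma exp_prelie_Ad g1 g2 : g1 1 = 0 -> g2 1 = 0 ->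
  exp_prelie (Omega' g1) g2 = Ad (conv_inv (Eprec g1)) g2.
Proof.
move=> g10 g20; have [X1 _] := magnus_eq_Omega' g10.
have f1 := Eprec1 g10; have [ff' _] := conv_invP f1.
have E1 : exp_prelie (Omega' g1) g2 1 = 0 by apply: lsum_prelie1.
rewrite /Ad conv_invK// -[in RHS](exp_conv_Omega' g10) -hprec_exp_prelie//.
by rewrite hprec_hprec// exp_conv_Omega'// ff' hprec_aug.
Qed.

End MagnusExpansion.

Theorem lemma28 (k : fieldType) (k_char0 : [pchar k] =i pred0)
    (H : unshuffleBialgebra k) (A : comAlgType k)
    (gamma1 gamma2 : {linear H -> A}) :
  infchar gamma1 -> infchar gamma2 ->
  lshuffle gamma1 gamma2 = gamma1 + exp_prelie (Omega' gamma1) gamma2 /\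
  lshuffle gamma1 gamma2 = gamma1 + Ad (conv_inv (Eprec gamma1)) gamma2.
Proof.
move=> [gamma11 _] [gamma21 _].
by rewrite exp_prelie_Ad// lshuffle_Ad.
Qed.
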